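(* Let $\mu=(\mu_1,\dots,\mu_k)$ be a vector of Borel probability measures on $\mathbb{R}^d$. Assume that for every $q\in\mathbb{R}^k$ there are $t_q\in\mathbb{R}$, $r_q>0$, $\underline{K}_q,\overline{K}_q>0$, a Borel probability measure $\nu_q$ supported by $\mathrm{Support}(\mu)$, a function $\varphi_q:\mathbb{R}_+\to\mathbb{R}$ with $\varphi_q(r)=o(\log r)$ as $r\to0$, and a sequence $(r_{q,n})_n\subset(0,1)$ decreasing to $0$ with $\frac{\log r_{q,n+1}}{\log r_{q,n}}\to1$ and $\sum_nr_{q,n}^\varepsilon<\infty$ for all $\varepsilon>0$, such that: (A1) for all $x\in\mathrm{Support}(\mu)$ and $r\in(0,r_q)$, $$\underline{K}_q\le\frac{\nu_q(B(x,r))}{(\mu(B(x,r)))^q(2r)^{t_q}\exp(\varphi_q(r))}\le\overline{K}_q;$$ (A2) the limit $C_q(p)=\lim_{n\to\infty}\frac{1}{-\log r_{q,n}}\log\left(\int_{\mathrm{Support}(\mu)}(\mu(B(x,r_{q,n})))^p\,d\nu_q(x)\right)$ exists and is finite for all $p\in\mathbb{R}^k$. Then: (i) whenever $B_\mu$ is differentiable at $q$, one has $\alpha_\mu(x)=-\nabla B_\mu(q)$ for $\nu_q$-almost every $x$ (in particular the local dimensions exist there); (ii) $\mathrm{Dom}(B)\subseteq\alpha_\mu(\mathrm{Support}(\mu))$, and $f_\mu=B_\mu^*$ on $\mathrm{Dom}(B)$, where $\mathrm{Dom}(B)=\{-\nabla B_\mu(q):\ q\in\mathbb{R}^k,\ B_\mu\text{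 differentiable at }q\}$.
   Context: $d,k\ge1$ are integers; $B(x,r)$ is the closed ball of center $x$ and radius $r$ in $\mathbb{R}^d$. $\mathrm{Support}(\mu)$ is the set of $x\in\mathbb{R}^d$ with $\mu_j(B(x,r))>0$ for all $r>0$ and all $j=1,\dots,k$. For $p\in\mathbb{R}^k$, $(\mu(B(x,r)))^p=\prod_{j=1}^k\mu_j(B(x,r))^{p_j}$, with conventions $0^s=+\infty$ for $s<0$, $0^0=1$, $0\cdot\infty=0$. $\dim$ is Hausdorff dimension. A centered $\epsilon$-packing of $E\subseteq\mathbb{R}^d$ is a countable family of pairwise disjoint balls $B(x_i,r_i)$ with $x_i\in E$, $r_i<\epsilon$. For $q\in\mathbb{R}^k$, $t\in\mathbb{R}$: $\overline{\mathcal P}_{\mu,\epsilon}^{q,t}(E)=\sup\sum_i(\mu(B(x_i,r_i)))^q(2r_i)^t$ over centered $\epsilon$-packings of $E$ ($0$ if $E=\emptyset$), $\overline{\mathcal P}_\mu^{q,t}(E)=\lim_{\epsilon\downarrow0}\overline{\mathcal P}_{\mu,\epsilon}^{q,t}(E)$, and $\mathcal P_\mu^{q,t}(E)=\inf\{\sum_i\overline{\mathcal P}_\mu^{q,t}(E_i):E\subseteq\bigcup_iE_i\}$ (countable covers). $B_\mu(q)\in[-\infty,+\infty]$ is the unique number such that $\mathcal P_\mu^{q,t}(\mathrm{Support}(\mu))=+\infty$ for $t<B_\mu(q)$ and $=0$ for $t>B_\mu(q)$. Local dimensions: $\alpha_{\mu_j}(x)=\lim_{r\downarrow0}\frac{\log\mu_j(B(x,r))}{\log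 r}$ when the limit exists, and $\alpha_\mu(x)=(\alpha_{\mu_1}(x),\dots,\alpha_{\mu_k}(x))$ when all of them exist; $\alpha_\mu(\mathrm{Support}(\mu))$ is the set of values $\alpha_\mu(x)$ over those $x\in\mathrm{Support}(\mu)$ at which $\alpha_\mu(x)$ exists. For $\alpha\in\mathbb{R}^k_+$ (all coordinates $\ge 0$), $X(\alpha)=\{x\in\mathrm{Support}(\mu):\alpha_\mu(x)\text{ exists and equals }\alpha\}$ and $f_\mu(\alpha)=\dim X(\alpha)$ is the mixed multifractal spectrum. The Legendre transform is $B_\mu^*(\alpha)=\inf_{q\in\mathbb{R}^k}(\langle\alpha,q\rangle+B_\mu(q))$. *)

(* Defs.v *)
From HB Require Import structures.
From mathcomp Require Import all_boot all_order all_algebra.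
From mathcomp Require Import all_classical all_reals all_analysis.

Set Implicit Arguments.
Unset Strict Implicit.
Unset Printing Implicit Defensive.

Import Order.TTheory GRing.Theory Num.Theory.
Import numFieldNormedType.Exports.

Local Open Scope classical_set_scope.
Local Open Scope ring_scope.
Local Open Scope ereal_scope.

(* The library norm on ['rV[R]_d] is the sup norm; balls and diameters below
   are Euclidean.  Both norms induce the same topology, hence the same Borel
   sets. *)
Definition enorm (R : realType) (d : nat) (v : 'rV[R]_d) : R :=
  Num.sqrt (\sum_(i < d) v ord0 i ^+ 2)%R.

Definition eball (R : realType) (d : nat) (x : 'rV[R]_d) (r : R) :
    set 'rV[R]_d :=
  [set y | (enorm (y - x) <= r)%R].

Definition dotp (R : realType) (n : nat) (u v : 'rV[R]_n) : R :=
  (\sum_(i < n) u ord0 i * v ord0 i)%R.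

(* R^d equipped with its Borel sigma-algebra. *)
Notation borel R d := (g_sigma_algebraType (@open 'rV[R]_d)).

Section Hausdorff.
Context (R : realType) (d : nat).
Implicit Types (U E : set 'rV[R]_d) (s delta : R).

(* Equal to -oo on the empty set. *)
Definition ediam U : \bar R :=
  ereal_sup [set (enorm (z.1 - z.2))%:E | z in U `*` U].

(* [poweR 0 0 = 1], so that H^0 counts points, except that the empty set
   contributes nothing. *)
Definition diam_pow s U : \bar R :=
  if U == set0 then 0 else poweR (ediam U) s.

Definition hausdorff_pre s delta E : \bar R :=
  ereal_inf [set \sum_(i <oo) diam_pow s (U i) | U in
    [set U : (set 'rV[R]_d)^nat |
      E `<=` \bigcup_i U i /\ forall i, ediam (U i) <= delta%:E]].

Definition hausdorff_measure s E : \bar R :=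
  lim (hausdorff_pre s delta E @[delta --> 0^'+]).

Definition hausdorff_dim E : \bar R :=
  ereal_inf [set s%:E | s in [set s | (0 <= s)%R /\ hausdorff_measure s E = 0]].

End Hausdorff.

(* Unlike [poweR], which sends 0 to 0 for every nonzero exponent, this follows
   the convention 0^s = +oo for s < 0. *)
Definition powcv (R : realType) (x : \bar R) (s : R) : \bar R :=
  if (x == 0) && (s < 0)%R then +oo else poweR x s.

Section Multifractal.
Context (R : realType) (d k : nat).
Variable mu : 'I_k -> probability (borel R d) R.
Implicit Types (x : 'rV[R]_d) (E : set 'rV[R]_d) (p q alpha : 'rV[R]_k).
Implicit Types (r t eps : R).

Definition msupport : set 'rV[R]_d :=
  [set x | forall (r : R) (j : 'I_k), (0 < r)%R -> 0 < mu j (eball x r)].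

(* [mule] satisfies 0 * oo = 0. *)
Definition mupow (A : set 'rV[R]_d) p : \bar R :=
  \prod_(j < k) powcv (mu j A) (p ord0 j).

(* A countable family of balls is indexed by an arbitrary D : set nat. *)
Definition centered_packing eps E (D : set nat)
    (x : nat -> 'rV[R]_d) (r : nat -> R) : Prop :=
  (forall i, D i -> [/\ E (x i), (0 < r i)%R & (r i < eps)%R]) /\
  trivIset D (fun i => eball (x i) (r i)).

Definition packing_pre_eps q t eps E : \bar R :=
  ereal_sup [set s | exists (D : set nat) (x : nat -> 'rV[R]_d) (r : nat -> R),
    centered_packing eps E D x r /\
    s = \esum_(i in D)
          (mupow (eball (x i) (r i)) q * (powR (2 * r i) t)%:E)].

Definition packing_pre q t E : \bar R :=
  lim (packing_pre_eps q t eps E @[eps --> 0^'+]).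

Definition packing_measure q t E : \bar R :=
  ereal_inf [set \sum_(i <oo) packing_pre q t (F i) | F in
    [set F : (set 'rV[R]_d)^nat | E `<=` \bigcup_i F i]].

Definition B_mu q : \bar R :=
  get [set b : \bar R | forall t : R,
    (t%:E < b -> packing_measure q t msupport = +oo) /\
    (b < t%:E -> packing_measure q t msupport = 0)].

(* [lne 0 = -oo], so the quotient is +oo when the ball is negligible. *)
Definition has_local_dim (m : probability (borel R d) R) x (a : R) : Prop :=
  (lne (m (eball x r)) * ((ln r)^-1)%:E) @[r --> 0^'+] --> a%:E.

Definition has_alpha x alpha : Prop :=
  forall j : 'I_k, has_local_dim (mu j) x (alpha ord0 j).

Definition alpha_image : set 'rV[R]_k :=
  [set alpha | exists2 x, msupport x & has_alpha x alpha].

Definition Xset alpha : set 'rV[R]_d :=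
  [set x | msupport x /\ has_alpha x alpha].

Definition f_mu alpha : \bar R := hausdorff_dim (Xset alpha).

End Multifractal.

Section Legendre.
Context (R : realType) (k : nat).
Implicit Types (f : 'rV[R]_k -> \bar R) (q alpha : 'rV[R]_k).

Definition legendre f alpha : \bar R :=
  ereal_inf (range (fun q => (dotp alpha q)%:E + f q)).

Definition ediff f q : Prop :=
  (\forall q' \near q, f q' \is a fin_num) /\
  differentiable (fun q' => fine (f q')) q.

Definition egrad f q : 'rV[R]_k :=
  \row_(j < k) ('D_(delta_mx ord0 j) (fun q' => fine (f q')) q).

Definition grad_dom f : set 'rV[R]_k :=
  [set (- egrad f q)%R | q in [set q | ediff f q]].

End Legendre.

(* Main.v *)
Require Import Defs.
From HB Require Import structures.
From mathcomp Require Import all_boot all_order all_algebra.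
From mathcomp Require Import all_classical all_reals all_analysis.
From mathcomp Require Import ring lra.

Import Order.TTheory GRing.Theory Num.Theory.
Import numFieldNormedType.Exports.

(** Everything follows from comparing each [nu q] with the product
    [mu(B)^q r^(t q)], which is uniform on the support up to factors
    [r^(o(1))] (predicate [gibbs]), together with one covering device
    ([grid_packing]): any set [E] is covered by balls of a given radius
    centred in [E] which split into a number of packings depending only on
    the dimension.

    - [B_mu q = t q] ([B_muE]). At an exponent above [t q], the packing sums
      are a small power of the radius times the [nu q]-mass of disjoint balls,
      so they tend to 0. Below [t q], they are a large negative power of the
      radius times that mass; in a countable cover of the support some piece
      has a closure of positive [nu q]-mass, and the covering device produces
      packings of this piece which carry a fixed proportion of it.

    - Large deviations ([gibbs_deviation]). At a point where
      [mu(B)^(q' - q) >= r^(t q - t q' - 2 e)], the comparison gives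
      [nu q (B) <= r^e nu q' (B)]. Covering the set of such points by boundedly
      many packings bounds its [nu q]-mass by a constant times [r^e]. By the
      Borel-Cantelli lemma along the radii [rn q n], almost every point
      eventually leaves these sets. With [q' = q + s e_j] and [q' = q - s e_j],
      the quotient [log mu_j(B) / log r] is trapped, up to [s], between the
      opposites of the two difference quotients of [t]; letting [s] go to 0
      gives the limit [- d_j t (q)] along the sequence, and then along all
      radii because [log] varies little between consecutive ones
      ([ae_has_alpha]). This is (i), and with it the inclusion in (ii).

    - Spectrum. On [Xset alpha] every [nu p] has local dimension
      [<alpha, p> + t p] ([Xset_gibbs]). Covering by balls gives
      [dim <= <alpha, p> + t p] for every [p] ([hausdorff_dim_Xset_le]), that
      is [f_mu alpha <= B*(alpha)]; if [alpha = - grad B(q)], then [nu q] is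
      carried by [Xset alpha] and the mass distribution principle gives
      [dim >= <alpha, q> + t q >= B*(alpha)] ([hausdorff_dim_Xset_ge]). *)

Local Open Scope classical_set_scope.
Local Open Scope ring_scope.

(** * Euclidean balls and a coloured grid cover *)

Lemma coord_le_enorm {R : realType} {d} (v : 'rV[R]_d) i :
  `|v ord0 i| <= enorm v.
Proof.
rewrite -sqrtr_sqr /enorm ler_wsqrtr // (bigD1 i) //= lerDl.
by apply: sumr_ge0 => j _; rewrite sqr_ge0.
Qed.

Lemma enorm_le_coord {R : realType} {d} (v : 'rV[R]_d) (c : R) :
  (forall i, `|v ord0 i| <= c) -> enorm v <= d%:R * c.
Proof.
case: d v => [|d] v vc.
  by rewrite /enorm big_ord0 sqrtr0 mul0r.
have c0 : 0 <= c by apply: le_trans (vc ord0).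
rewrite -[leRHS]ger0_norm ?mulr_ge0// -sqrtr_sqr /enorm ler_wsqrtr//.
apply: (@le_trans _ _ (\sum_(i < d.+1) c ^+ 2)).
  apply: ler_sum => i _; rewrite -[leLHS]ger0_norm ?sqr_ge0// normrX.
  by rewrite lerXn2r// ?nnegrE.
rewrite sumr_const card_ord -[leLHS]mulr_natl exprMn ler_wpM2r ?sqr_ge0//.
by rewrite -natrX ler_nat leq_pmulr.
Qed.

Lemma enorm_ge0 {R : realType} {d} (v : 'rV[R]_d) : 0 <= enorm v.
Proof. exact: sqrtr_ge0. Qed.

Lemma eball_center {R : realType} {d} (x : 'rV[R]_d) (r : R) :
  0 <= r -> eball x r x.
Proof.
move=> r0; rewrite /eball /= subrr /enorm big1 ?sqrtr0// => i _.
by rewrite mxE expr0n.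
Qed.

Lemma subset_eball {R : realType} {d} (x : 'rV[R]_d) (r s : R) :
  r <= s -> eball x r `<=` eball x s.
Proof. by move=> rs y /= /le_trans; apply. Qed.

Lemma near_coord {R : realType} {d} (x : 'rV[R]_d) (c : R) : 0 < c ->
  nbhs x [set y : 'rV[R]_d | forall i, (`|y ord0 i - x ord0 i| <= c)].
Proof.
move=> c0; apply: (@filter_forall _ 'I_d (fun i y => `|y ord0 i - x ord0 i| <= c)
  (nbhs x)) => i.
have /cvgrPdist_le/(_ _ c0) := @coord_continuous R 1 d ord0 i x.
by apply: filterS => y; rewrite distrC.
Qed.

Lemma closed_eball {R : realType} {d} (x : 'rV[R]_d) (r : R) :
  closed (eball x r).
Proof.
rewrite (_ : eball x r = (fun y => enorm (y - x)) @^-1` [set s | s <= r])//.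
apply: preimage_closed; last exact: closed_le.
move=> y _; rewrite /enorm.
apply: (@continuous_comp _ _ _
  (fun y : 'rV[R]_d => \sum_(i < d) (y - x) ord0 i ^+ 2) Num.sqrt);
  last exact: sqrt_continuous.
elim: (index_enum _) => [|i s IH].
  rewrite (_ : (fun _ => _) = cst (0 : R)); first exact: cst_continuous.
  by apply/funext => z; rewrite big_nil.
rewrite (_ : (fun _ => _) = ((fun s => s ^+ 2) \o (fun z : 'rV[R]_d =>
    z ord0 i - x ord0 i) \+
    (fun z : 'rV[R]_d => \sum_(j <- s) (z - x) ord0 j ^+ 2))); last first.
  by apply/funext => z /=; rewrite big_cons !mxE.
apply: continuousD IH; apply: continuous_comp; last exact: exprn_continuous.
apply: continuousB; last exact: cst_continuous.
exact: coord_continuous.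
Qed.

Lemma closed_borel {R : realType} {d} (A : set 'rV[R]_d) :
  closed A -> measurable (A : set (borel R d)).
Proof.
move=> cA; rewrite -(setCK A); apply: measurableC.
by apply: sub_sigma_algebra; exact: closed_openC.
Qed.

Lemma measurable_eball {R : realType} {d} (x : 'rV[R]_d) (r : R) :
  measurable (eball x r : set (borel R d)).
Proof. by apply: closed_borel; exact: closed_eball. Qed.

(** Coordinatewise control stands in for the triangle inequality of [enorm]:
    every estimate below tolerates factors depending on [d]. *)
Lemma eball_sub_coord {R : realType} {d} (x y : 'rV[R]_d) (c r : R) :
  0 <= c ->
  (forall i, `|y ord0 i - x ord0 i| <= c) -> 2 * d%:R * c <= r ->
  eball y c `<=` eball x r.
Proof.
move=> c0 xy cr z /= yz; apply: le_trans cr.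
rewrite [2 * _]mulrC -mulrA; apply: enorm_le_coord => i.
have zy := le_trans (coord_le_enorm _ i) yz; move: zy; rewrite !mxE => zy.
rewrite (_ : z ord0 i - _ = (z ord0 i - y ord0 i) + (y ord0 i - x ord0 i)); last by ring.
by rewrite (le_trans (ler_normD _ _))// mulr_natl mulr2n lerD.
Qed.

(** A point [x] of the closure has a support point [y] so near that a ball
    around [y], of positive mass, lies inside [eball x r]. *)
Lemma closed_msupport {R : realType} {d k} (hd : (0 < d)%N)
  (mu : 'I_k -> probability (borel R d) R) : closed (msupport mu).
Proof.
move=> x clx r j r0.
pose c : R := r / (2 * d%:R).
have c0 : 0 < c by rewrite divr_gt0// mulr_gt0// ltr0n.
have [y [Sy xy]] := clx _ (near_coord x _ c0).
apply: (lt_le_trans (Sy c j c0)).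
apply: le_measure; rewrite ?inE; try exact: measurable_eball.
apply: eball_sub_coord (ltW c0) xy _.
by rewrite /c mulrC divfK// mulf_neq0// pnatr_eq0 -?lt0n.
Qed.

Lemma measurable_msupport {R : realType} {d k} (hd : (0 < d)%N)
  (mu : 'I_k -> probability (borel R d) R) :
  measurable (msupport mu : set (borel R d)).
Proof. by apply: closed_borel; exact: closed_msupport. Qed.

Lemma eball_coord_disjoint {R : realType} {d} (x y : 'rV[R]_d) (r : R) i :
  2 * r < `|x ord0 i - y ord0 i| -> eball x r `&` eball y r = set0.
Proof.
move=> xy; rewrite -subset0 => z [/= zx zy].
have := le_trans (coord_le_enorm _ i) zx; rewrite !mxE => {}zx.
have := le_trans (coord_le_enorm _ i) zy; rewrite !mxE => {}zy.
move: xy; apply/negP; rewrite -leNgt.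
rewrite (_ : x ord0 i - _ = - (z ord0 i - x ord0 i) + (z ord0 i - y ord0 i)); last by ring.
by rewrite (le_trans (ler_normD _ _))// normrN mulr_natl mulr2n lerD.
Qed.

(** The instance of the Besicovitch covering theorem for balls of equal radius.
    Choose one point of [E] in each cell of a grid that meets [E], and colour a
    cell by its integer coordinates modulo [4 d + 2]: distinct cells of the
    same colour are so far apart that the balls around their points are
    disjoint. Covering the closure, and not only [E], allows a set that is not
    measurable to be replaced by one that is. *)
Lemma grid_packing (R : realType) d : (0 < d)%N -> exists C : finType,
  forall (E : set 'rV[R]_d) (delta : R), 0 < delta ->
  exists (x : nat -> 'rV[R]_d) (D : set nat) (col : nat -> C),
  [/\ forall i, D i -> E (x i),
      forall c, trivIset (D `&` [set i | col i = c]) (fun i => eball (x i) delta) &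
      closure E `<=` \bigcup_(i in D) eball (x i) delta].
Proof.
move=> hd; pose M := (4 * d).+2.
exists {ffun 'I_d -> 'I_M} => E delta delta0.
have d0 : 0 < d%:R :> R by rewrite ltr0n.
(* With this mesh, two points of a cell differ by less than [delta / 2] in
   Euclidean norm, which leaves [delta / 2] to reach the closure; and cells
   whose indices differ by [4 d + 2] in some coordinate are at distance at
   least [(4 d + 1) s > 2 delta]. *)
pose s : R := delta / (2 * d%:R).
have s0 : 0 < s by rewrite divr_gt0// mulr_gt0.
have ds : d%:R * (s + s) = delta by rewrite /s; field; rewrite gt_eqF.
pose cell (y : 'rV[R]_d) : 'rV[int]_d := (\row_i Num.floor (y ord0 i / s)).
pose col (v : 'rV[int]_d) : {ffun 'I_d -> 'I_M} :=
  [ffun i => inord `|(v ord0 i %% M%:Z)%Z|%N].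
pose x n := xget 0 [set y | E y /\ pickle (cell y) = n].
pose D := [set n | exists2 y, E y & pickle (cell y) = n].
have xP n : D n -> E (x n) /\ pickle (cell (x n)) = n.
  move=> [y Ey yn].
  by apply: (@xgetPex _ 0 [set y | E y /\ pickle (cell y) = n]); exists y.
have cellP y i : ((cell y ord0 i)%:~R * s <= y ord0 i < (cell y ord0 i)%:~R * s + s).
  rewrite mxE; have /andP[h1 h2] := floor_itv (y ord0 i / s).
  rewrite -ler_pdivlMr// h1 /=.
  by move: h2; rewrite ltr_pdivrMr// intrD mulrDl mul1r.
exists x, D, (fun n => col (cell (x n))); split.
- by move=> i /xP[].
- move=> c; apply/trivIsetP => m n [/xP[_ xm] /= cm] [/xP[_ xn] /= cn] mn.
  have [i mni] : exists i, cell (x m) ord0 i != cell (x n) ord0 i.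
    apply/existsP; rewrite -negb_forall; apply: contra mn => /forallP mn.
    rewrite -xm -xn; apply/eqP; congr pickle; apply/rowP => i.
    by apply/eqP; exact: mn.
  apply: (@eball_coord_disjoint _ _ _ _ _ i).
  have /(congr1 (fun f : {ffun 'I_d -> 'I_M} => (f i : nat))) : col (cell (x m)) = col (cell (x n)).
    by rewrite cm cn.
  rewrite !ffunE.
  move: (cellP (x m) i) (cellP (x n) i) mni.
  move: (cell (x m) ord0 i) (cell (x n) ord0 i) => a b ha hb ab.
  have inM (z : int) : (`|(z %% M%:Z)%Z| < M)%N.
    by rewrite -ltz_nat gez0_abs ?modz_ge0// ltz_pmod.
  rewrite !inordK// => abM.
  have {}abM : (M%:Z %| (a - b))%Z.
    rewrite -eqz_mod_dvd -(@gez0_abs (a %% M)%Z) ?modz_ge0//.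
    by rewrite abM gez0_abs ?modz_ge0.
  have : (M%:Z <= `|a - b|).
    move: abM; rewrite /dvdz /= => /dvdn_leq; rewrite absz_gt0 subr_eq0 => /(_ ab).
    by rewrite -lez_nat abszE.
  rewrite -(ler_int R) intr_norm rmorphB /= => MR.
  have : ((4 * d%:R + 2) * s <= `|a%:~R - b%:~R| * s).
    rewrite ler_pM2r//; apply: le_trans MR.
    by rewrite -pmulrn /M -[(4 * d).+2]addn2 natrD natrM.
  have -> : 2 * delta = 4 * d%:R * s by rewrite -ds; ring.
  case: (ltrgtP a b) ab => // ab _.
    rewrite distrC (distrC (x m _ _)) ger0_norm ?subr_ge0 ?ler_int ?(ltW ab)//.
    by move=> h; apply: lt_le_trans (ler_norm _); nra.
  rewrite ger0_norm ?subr_ge0 ?ler_int ?(ltW ab)//.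
  by move=> h; apply: lt_le_trans (ler_norm _); nra.
- move=> y Ey; have [z [Ez zy]] := Ey _ (near_coord y _ s0).
  have Dz : D (pickle (cell z)) by exists z.
  exists (pickle (cell z)) => //; have [_ /(pcan_inj pickleK) xz] := xP _ Dz.
  move: xz; set w := x _ => xz; rewrite /eball /= -ds.
  apply: enorm_le_coord => i; rewrite !mxE.
  rewrite (_ : (y ord0 i - w ord0 i = (z ord0 i - w ord0 i) - (z ord0 i - y ord0 i))); last by ring.
  apply: le_trans (ler_normB _ _) _; rewrite lerD//.
  have := cellP w i; have := cellP z i; rewrite xz => /andP[h1 h2] /andP[h3 h4].
  by rewrite ler_norml; apply/andP; split; lra.
Qed.

(** * The comparison between [nu] and powers of [mu] *)

Section LogMass.
Context {R : realType} {d k : nat} (mu : 'I_k -> probability (borel R d) R).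
Implicit Types (x : 'rV[R]_d) (r : R) (p q : 'rV[R]_k).

Definition logmass x r : 'rV[R]_k := \row_j ln (fine (mu j (eball x r))).

Lemma msupport_fine_gt0 x r j : msupport mu x -> 0 < r ->
  0 < fine (mu j (eball x r)).
Proof.
move=> Sx r0; rewrite fine_gt0// Sx//= ltey_eq.
by rewrite fin_num_measure//; exact: measurable_eball.
Qed.

Lemma mupowE p x r : msupport mu x -> 0 < r ->
  mupow mu (eball x r) p = (expR (dotp p (logmass x r)))%:E.
Proof.
move=> Sx r0; rewrite /mupow /dotp expR_sum -prodEFin.
apply: eq_bigr => j _; have m0 := msupport_fine_gt0 _ _ j Sx r0.
rewrite /powcv gt_eqF ?Sx//= -[X in poweR X _]fineK; last first.
  by rewrite fin_num_measure//; exact: measurable_eball.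
by rewrite poweR_EFin /powR gt_eqF// mxE.
Qed.

Lemma dotpDl p q (l : 'rV[R]_k) : dotp (p + q) l = dotp p l + dotp q l.
Proof. by rewrite /dotp -big_split; apply: eq_bigr => i _; rewrite mxE mulrDl. Qed.

(** On the support, [expR (dotp q (logmass x r))] is [mu(B)^q], so that this says
    [mu(B)^q r^(a + e) <= nu(B) <= mu(B)^q r^(a - e)]. *)
Definition gibbs_bounds q (a : R) (nu : probability (borel R d) R) (e r : R) :=
  forall x, msupport mu x ->
    ((expR (dotp q (logmass x r) + (a + e) * ln r))%:E <= nu (eball x r) <=
     (expR (dotp q (logmass x r) + (a - e) * ln r))%:E)%E.

Definition gibbs q (a : R) (nu : probability (borel R d) R) :=
  forall e, 0 < e -> \forall r \near 0^'+, gibbs_bounds q a nu e r.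

Lemma near_ln_lt (c : R) : \forall r \near 0^'+, ln r < c.
Proof.
near=> r.
have r0 : 0 < r by near: r; exact: nbhs_right_gt.
have rc : r < expR c by near: r; apply: nbhs_right_lt; exact: expR_gt0.
by rewrite -[ltRHS]expRK ltr_ln ?posrE ?expR_gt0.
Unshelve. all: by end_near. Qed.

(** The constants [Klow] and [Kup], the factor [2^a] and [expR (phi r)] all lie
    between [r^e] and [r^-e] for small [r], since [ln r] tends to [-oo]. *)
Lemma gibbs_of_bounds q (a r0 Klow Kup : R) (phi : R -> R)
    (nu : probability (borel R d) R) :
  0 < r0 -> 0 < Klow -> 0 < Kup -> phi =o_ (0^'+) (@ln R) ->
  (forall x r, msupport mu x -> 0 < r < r0 ->
    (Klow%:E <= nu (eball x r) /
      (mupow mu (eball x r) q * (powR (2 * r) a)%:E * (expR (phi r))%:E)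
     <= Kup%:E)%E) ->
  gibbs q a nu.
Proof.
move=> r00 Kl Ku /eqoP phi_o A1 e e0.
(* [c] collects what does not depend on [r]; the exponent [e] is shared equally
   between [c] and [phi r]. *)
pose c := `|ln Klow| + `|ln Kup| + `|a * ln 2|.
have e20 : 0 < e / 2 by rewrite divr_gt0.
near=> r => x Sx.
have rgt0 : 0 < r by near: r; exact: nbhs_right_gt.
have rr0 : r < r0 by near: r; exact: nbhs_right_lt.
have phir : `|phi r| <= e / 2 * `|ln r| by near: r; exact: phi_o.
have lnr : ln r < - (2 * c / e) by near: r; exact: near_ln_lt.
have {lnr} [lnr0 cr] : ln r < 0 /\ c <= - (e / 2 * ln r).
  have c0 : 0 <= c by rewrite /c !addr_ge0.
  split; first by apply: lt_le_trans lnr _; rewrite oppr_le0 divr_ge0 ?mulr_ge0// ltW.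
  have : e / 2 * (2 * c / e) < e / 2 * - ln r by rewrite ltr_pM2l// ltrNr.
  rewrite (_ : e / 2 * (2 * c / e) = c); last by field; rewrite gt_eqF.
  by rewrite mulrN => /ltW.
have := A1 x r Sx; rewrite rgt0 rr0 => /(_ isT).
rewrite mupowE// {1 2}/powR gt_eqF ?mulr_gt0// -!EFinM -!expRD.
set D := _ + _ + _.
have nuf : nu (eball x r) \is a fin_num.
  by rewrite fin_num_measure//; exact: measurable_eball.
rewrite -[X in (_ <= X / _)%E]fineK// -(fineK nuf) inver gt_eqF ?expR_gt0//.
rewrite -EFinM !lee_fin ler_pdivlMr ?expR_gt0// ler_pdivrMr ?expR_gt0//.
rewrite -[in X in X -> _](lnK Kl) -[in X in X -> _](lnK Ku) -!expRD.
rewrite /D lnM ?posrE// => /andP[h1 h2].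
move: phir; rewrite (ltr0_norm lnr0) ler_norml => /andP[p1 p2].
have k1 := ler_norm (- ln Klow); have k2 := ler_norm (ln Kup).
have k3 := ler_norm (a * ln 2); have k4 := ler_norm (- (a * ln 2)).
rewrite !normrN in k1 k4.
have n1 := normr_ge0 (ln Klow); have n2 := normr_ge0 (ln Kup).
apply/andP; split.
  apply: le_trans h1; rewrite ler_expR /c in cr *; lra.
apply: le_trans h2 _; rewrite ler_expR /c in cr *; lra.
Unshelve. all: by end_near. Qed.

End LogMass.

(** * Sums over packings and large deviations *)

(** Splitting a sum by colours turns a bound valid for packings into one valid
    for the covers of [grid_packing], at the price of the factor [#|C|]. *)
Lemma esum_colored_le {R : realType} (C : finType) (D : set nat)
    (col : nat -> C) (a : nat -> \bar R) (M : R) :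
  (forall i, D i -> (0 <= a i)%E) ->
  (forall c, (\esum_(i in D `&` [set i | col i = c]) a i <= M%:E)%E) ->
  (\esum_(i in D) a i <= (#|C|%:R * M)%:E)%E.
Proof.
move=> a0 aM.
pose b c i := if i \in D `&` [set i | col i = c] then a i else 0%E.
have b0 c i : (0 <= b c i)%E.
  by rewrite /b; case: ifPn => // /set_mem[/a0].
have bE i : (if i \in D then a i else 0%E) = (\sum_(c : C) b c i)%E.
  rewrite (bigD1 (col i)) //= big1 ?adde0; last first.
    move=> c ci; rewrite /b; case: ifPn => // /set_mem[_ /= ic].
    by rewrite ic eqxx in ci.
  rewrite /b; case: ifPn => [/set_mem Di|/negP Di]; first by rewrite mem_set.
  by rewrite memNset// => -[/mem_set].
have -> : \esum_(i in D) a i = (\sum_(c : C) \esum_(i in D `&` [set i | col i = c]) a i)%E.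
  have bsum c : (\esum_(i in D `&` [set i | col i = c]) a i = \sum_(n <oo) b c n)%E.
    by rewrite esum_mkcond nneseries_esumT.
  under [RHS]eq_bigr do rewrite bsum.
  rewrite -nneseries_sum// esum_mkcond nneseries_esumT; last first.
    by move=> n; exact: sume_ge0.
  by apply: eq_esum => i _; exact: bE.
apply: (@le_trans _ _ (\sum_(c : C) M%:E)%E); first by apply: lee_sum => c _.
by rewrite sumEFin lee_fin sumr_const mulr_natl.
Qed.

Section BorelSums.
Context {R : realType} {d : nat} (nu : probability (borel R d) R).

Lemma packing_esum_le1 (D : set nat) (x : nat -> 'rV[R]_d) (r : nat -> R) :
  trivIset D (fun i => eball (x i) (r i)) ->
  (\esum_(i in D) nu (eball (x i) (r i)) <= 1)%E.
Proof.
move=> tD; rewrite -(set_mem_set D) -nneseries_esum//.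
rewrite -(measure_bigcup nu D (fun i => eball (x i) (r i)))//; last first.
  by move=> i _; exact: measurable_eball.
apply: probability_le1; apply: bigcup_measurable => i _.
exact: measurable_eball.
Qed.

Lemma cover_esum (A : set 'rV[R]_d) (D : set nat) (F : nat -> set 'rV[R]_d) :
  measurable (A : set (borel R d)) ->
  (forall i, measurable (F i : set (borel R d))) ->
  A `<=` \bigcup_(i in D) F i -> (nu A <= \esum_(i in D) nu (F i))%E.
Proof.
move=> mA mF AF.
pose G i := if i \in D then F i else set0.
have mG i : measurable (G i : set (borel R d)).
  by rewrite /G; case: ifPn => // _; exact: measurable0.
have AG : A `<=` \bigcup_i G i.
  by move=> y /AF[i Di Fy]; exists i => //; rewrite /G mem_set.
apply: (le_trans (measure_sigma_subadditive nu mG mA AG)).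
rewrite nneseries_esumT// [leRHS]esum_mkcond.
by apply: le_esum => i _; rewrite /G; case: ifPn => // _; rewrite measure0.
Qed.

End BorelSums.

Lemma esumZl {R : realType} (D : set nat) (a : nat -> \bar R) (c : R) :
  0 <= c -> (forall i, D i -> (0 <= a i)%E) ->
  (\esum_(i in D) (c%:E * a i) = c%:E * \esum_(i in D) a i)%E.
Proof.
move=> c0 a0; rewrite -(set_mem_set D) -!nneseries_esum ?nneseriesZl//.
- by move=> n /set_mem/a0.
- by move=> n /set_mem/a0.
- by move=> n /set_mem/a0 an; rewrite mule_ge0// lee_fin.
Qed.

(** Disjoint balls have total mass at most 1: this is how the mass of a
    probability controls packing sums. *)
Lemma packing_esum_le {R : realType} {d} (nu : probability (borel R d) R)
    (D : set nat) (x : nat -> 'rV[R]_d) (r : nat -> R) (a : nat -> \bar R)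
    (c : R) : 0 <= c ->
  trivIset D (fun i => eball (x i) (r i)) ->
  (forall i, D i -> (a i <= c%:E * nu (eball (x i) (r i)))%E) ->
  (\esum_(i in D) a i <= c%:E)%E.
Proof.
move=> c0 tD ac; apply: (le_trans (le_esum ac)).
rewrite esumZl// -[leRHS]mule1 lee_wpmul2l ?lee_fin//.
exact: packing_esum_le1.
Qed.

(** On this set of points, [mu(B)^(q' - q) >= r^(a - a' - 2 e)], so that
    [nu(B)], comparable to [mu(B)^q r^a], is at most [mu(B)^q' r^(a' + 2 e)],
    hence at most [r^e nu'(B)]. Summing over a grid cover of the set leaves
    [r^e] times the number of colours, because [nu'] has mass at most 1 on
    each packing. The conclusion is about a measurable hull of the set. *)
Lemma gibbs_deviation (R : realType) d (hd : (0 < d)%N) : exists N : nat,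
  forall k (mu : 'I_k -> probability (borel R d) R) (q q' : 'rV[R]_k)
    (a a' : R) (nu nu' : probability (borel R d) R),
  gibbs mu q a nu -> gibbs mu q' a' nu' ->
  forall e, 0 < e -> \forall r \near 0^'+, exists2 G : set (borel R d),
    measurable G /\ (nu G <= (N%:R * expR (e * ln r))%:E)%E &
    [set x | msupport mu x /\
      - (a' - a + 2 * e) * ln r <= dotp (q' - q) (logmass mu x r)] `<=` G.
Proof.
have [C grid] := grid_packing R d hd; exists #|C|.
move=> k mu q q' a a' nu nu' g g' e e0.
have e2 : 0 < e / 2 by rewrite divr_gt0.
near=> r.
have r0 : 0 < r by near: r; exact: nbhs_right_gt.
have gr : gibbs_bounds mu q a nu (e / 2) r by near: r; exact: g.
have gr' : gibbs_bounds mu q' a' nu' (e / 2) r by near: r; exact: g'.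
set E := [set x | _].
have [x [D [col [DE tD ED]]]] := grid E r r0.
have mB i : measurable (eball (x i) r : set (borel R d)) by exact: measurable_eball.
exists (\bigcup_(i in D) eball (x i) r); last first.
  by apply: subset_trans ED; exact: subset_closure.
have mG : measurable (\bigcup_(i in D) eball (x i) r : set (borel R d)).
  by apply: bigcup_measurable => i _; exact: mB.
split => //; apply: le_trans
  (cover_esum nu _ D (fun i => eball (x i) r) mG mB (@subset_refl _ _)) _.
apply: (@esum_colored_le _ _ _ col) => // c.
apply: (packing_esum_le nu' _ x (fun=> r)); rewrite ?expR_ge0// => i [/DE [Sx dx] _].
have /andP[_ h1] := gr _ Sx; have /andP[h2 _] := gr' _ Sx.
apply: le_trans h1 _; apply: le_trans (lee_wpmul2l _ h2); last by rewrite lee_fin expR_ge0.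
rewrite -EFinM lee_fin -expRD ler_expR.
move: dx; rewrite (_ : dotp q' _ = dotp (q' - q) (logmass mu (x i) r) +
  dotp q (logmass mu (x i) r)); last by rewrite -dotpDl subrK.
by lra.
Unshelve. all: by end_near. Qed.

(** * Almost sure local dimensions *)

Lemma near_right_cvg0 {R : realType} (P : set R) (u : nat -> R) :
  (forall n, 0 < u n) -> u n @[n --> \oo] --> 0 ->
  (\forall r \near 0^'+, P r) -> \forall n \near \oo, P (u n).
Proof.
move=> u0 u_cvg Pr; have : \forall n \near \oo, 0 < u n -> P (u n).
  exact: u_cvg Pr.
by apply: filterS => n; apply; exact: u0.
Qed.

(** Borel-Cantelli lemma for the sets of [gibbs_deviation] at the radii [u n]. *)
Lemma ae_gibbs_deviation (R : realType) d k (hd : (0 < d)%N)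
    (mu : 'I_k -> probability (borel R d) R) (q q' : 'rV[R]_k)
    (a a' : R) (nu nu' : probability (borel R d) R) (u : nat -> R) (e : R) :
  gibbs mu q a nu -> gibbs mu q' a' nu' -> 0 < e ->
  (forall n, 0 < u n) -> u n @[n --> \oo] --> 0 ->
  (\sum_(n <oo) (powR (u n) e)%:E < +oo)%E ->
  {ae nu, forall x, msupport mu x -> \forall n \near \oo,
     dotp (q' - q) (logmass mu x (u n)) < - (a' - a + 2 * e) * ln (u n)}.
Proof.
move=> g g' e0 u0 u_cvg u_sum.
have [N dev] := gibbs_deviation R d hd.
have [n0 _ devn] := near_right_cvg0 _ _ u0 u_cvg (dev _ _ _ _ _ _ _ _ g g' e e0).
pose Bad n := [set x | msupport mu x /\
  - (a' - a + 2 * e) * ln (u n) <= dotp (q' - q) (logmass mu x (u n))].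
have /choice[G GP] : forall n, exists G : set (borel R d),
    [/\ measurable G, (nu G <= (N%:R * expR (e * ln (u n)))%:E)%E &
        (n0 <= n)%N -> Bad n `<=` G].
  move=> n; have [n0n|nn0] := leqP n0 n.
    by have [G [mG nuG] badG] := devn n n0n; exists G.
  (* The first [n0] radii may be too large for the estimate; the empty set is
     harmless there, the limsup being insensitive to finitely many terms. *)
  by exists set0; split => //; rewrite measure0 lee_fin mulr_ge0 ?expR_ge0.
have mG n : measurable (G n) by have [] := GP n.
exists (lim_sup_set G); split.
- by apply: bigcap_measurable => // n _; exact: bigcup_measurable.
- apply: lim_sup_set_cvg0 => //.
  apply: (@le_lt_trans _ _ (\sum_(n <oo) N%:R%:E * (powR (u n) e)%:E)%E).
    apply: lee_nneseries => // n _; have [_ nuG _] := GP n.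
    by apply: le_trans nuG _; rewrite -EFinM /powR gt_eqF.
  rewrite nneseriesZl; last by move=> n _; rewrite lee_fin powR_ge0.
  by rewrite lte_mul_pinfty// lee_fin.
- move=> x /= /not_implyP[Sx nx] n _; apply: contrapT => nG; apply: nx.
  exists (maxn n n0) => // m /=; rewrite geq_max => /andP[nm n0m].
  rewrite ltNge; apply/negP => bad; apply: nG; exists m => //.
  by have [_ _ /(_ n0m)] := GP m; apply; split.
Qed.

(** If [u n.+1 <= r <= u n], then, [f] and [ln] being nondecreasing and
    nonpositive, [f r / ln r] lies between [f (u n) / ln (u n.+1)] and
    [f (u n.+1) / ln (u n)], which have the limit [D] since consecutive
    logarithms are equivalent. *)
Lemma cvg_ratio_of_seq {R : realType} (f : R -> R) (u : nat -> R) (D : R) :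
  (forall n, 0 < u n < 1) -> nonincreasing_seq u -> u n @[n --> \oo] --> 0 ->
  ln (u n.+1) / ln (u n) @[n --> \oo] --> (1 : R) ->
  (forall r s, 0 < r -> r <= s -> f r <= f s) -> (forall r, 0 < r -> f r <= 0) ->
  f (u n) / ln (u n) @[n --> \oo] --> D -> f r / ln r @[r --> 0^'+] --> D.
Proof.
move=> u01 u_noninc u_cvg rho_cvg f_homo f_le0 v_cvg.
have u0 n : 0 < u n by case/andP: (u01 n).
have lnu n : ln (u n) < 0 by rewrite ln_lt0.
pose lo n := f (u n) / ln (u n.+1); pose hi n := f (u n.+1) / ln (u n).
have lo_cvg : lo n @[n --> \oo] --> D.
  rewrite -[D](_ : D * 1^-1 = D); last by rewrite invr1 mulr1.
  rewrite (_ : lo = fun n => f (u n) / ln (u n) * (ln (u n.+1) / ln (u n))^-1).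
    by apply: cvgM => //; apply: cvgV => //; exact: oner_neq0.
  by apply/funext => n; rewrite /lo; field; rewrite !lt_eqF.
have hi_cvg : hi n @[n --> \oo] --> D.
  rewrite -[D]mulr1.
  rewrite (_ : hi = fun n => f (u n.+1) / ln (u n.+1) * (ln (u n.+1) / ln (u n))).
    apply: cvgM => //.
    by move: v_cvg; rewrite -cvg_shiftS.
  by apply/funext => n; rewrite /hi; field; rewrite !lt_eqF.
apply/cvgrPdist_le => e e0.
have [N _ lohi] : \forall n \near \oo, `|D - lo n| <= e /\ `|D - hi n| <= e.
  near=> n; split; near: n.
    by move/cvgrPdist_le: lo_cvg; apply.
  by move/cvgrPdist_le: hi_cvg; apply.
near=> r.
have r0 : 0 < r by near: r; exact: nbhs_right_gt.
have ruN : r < u N by near: r; exact: nbhs_right_lt.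
have exm : exists m, u m <= r.
  have /cvgrPdist_le/(_ r r0)[m _ /(_ m (leqnn m))] := u_cvg.
  by rewrite sub0r normrN gtr0_norm// => umr; exists m.
case: (ex_minnP exm) => -[|n] umr minm.
  by move: (le_lt_trans (u_noninc _ _ (leq0n N)) (le_lt_trans umr ruN)); rewrite ltxx.
have Nn : (N <= n)%N.
  rewrite leqNgt; apply/negP => nN.
  by move: (le_lt_trans (u_noninc _ _ nN) (le_lt_trans umr ruN)); rewrite ltxx.
have run : r < u n.
  by rewrite ltNge; apply/negP => /minm; rewrite ltnn.
have [hlo hhi] := lohi n Nn.
have lnr : ln r < 0 by apply: lt_trans (lnu n); rewrite ltr_ln ?posrE.
have lnrS : ln (u n.+1) <= ln r by rewrite ler_ln ?posrE.
have lnrn : ln r <= ln (u n) by rewrite ler_ln ?posrE// ltW.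
have lor : lo n <= f r / ln r.
  rewrite /lo -[leLHS]mulrNN -[leRHS]mulrNN -!invrN.
  apply: ler_pM; rewrite ?invr_ge0 ?oppr_ge0 ?f_le0 ?(ltW lnr) ?(ltW (lnu _))//.
    by rewrite lerN2 f_homo// ltW.
  by rewrite lef_pV2 ?posrE ?oppr_gt0// lerN2.
have rhi : f r / ln r <= hi n.
  rewrite /hi -[leLHS]mulrNN -[leRHS]mulrNN -!invrN.
  apply: ler_pM; rewrite ?invr_ge0 ?oppr_ge0 ?f_le0 ?(ltW lnr) ?(ltW (lnu _))//.
    by rewrite lerN2 f_homo.
  by rewrite lef_pV2 ?posrE ?oppr_gt0// lerN2.
move: hlo hhi; rewrite !ler_norml => /andP[? ?] /andP[? ?].
by apply/andP; split; lra.
Unshelve. all: by end_near. Qed.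

Lemma has_local_dimE {R : realType} {d k} (mu : 'I_k -> probability (borel R d) R)
    (x : 'rV[R]_d) (j : 'I_k) (D : R) : msupport mu x ->
  has_local_dim (mu j) x D <->
  logmass mu x r ord0 j / ln r @[r --> 0^'+] --> D.
Proof.
move=> Sx.
have E : \forall r \near 0^'+, (lne (mu j (eball x r)) * ((ln r)^-1)%:E)%E =
    (logmass mu x r ord0 j / ln r)%:E.
  near=> r; have r0 : 0 < r by near: r; exact: nbhs_right_gt.
  have m0 := msupport_fine_gt0 mu x r j Sx r0.
  rewrite -[X in lne X]fineK ?fin_num_measure//; last exact: measurable_eball.
  by rewrite lne_EFin// mxE.
rewrite /has_local_dim; split => h.
  have [_ {}h] := (fine_cvgP _ _).1 h; apply: cvg_trans h.
  by apply: near_eq_cvg; apply: filterS E => r /= ->.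
apply: (@cvg_trans _ ((logmass mu x r ord0 j / ln r)%:E @[r --> 0^'+])).
  by apply: near_eq_cvg; apply: filterS E => r ->.
by apply/fine_cvgP; split => //; exact: nearW.
Unshelve. all: by end_near. Qed.

Lemma dotp_delta {R : realType} {k} (c : R) (j : 'I_k) (l : 'rV[R]_k) :
  dotp (c *: delta_mx ord0 j) l = c * l ord0 j.
Proof.
rewrite /dotp (bigD1 j) //= big1 ?addr0 => [|i ij]; first by rewrite !mxE !eqxx mulr1.
by rewrite !mxE eqxx (negbTE ij) mulr0 mul0r.
Qed.

(** The deviation estimate towards [q + s e_j] bounds [log mu_j(B) / log r] from
    below by the opposite of the difference quotient of [t] with step [s], and
    the estimate towards [q - s e_j] bounds it from above by the opposite of the
    quotient with step [- s], both up to an error [s]. Differentiability makes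
    the two bounds agree when [s] tends to 0. *)
Lemma ae_has_alpha {R : realType} {d k} (hd : (0 < d)%N)
    (mu : 'I_k -> probability (borel R d) R) (t : 'rV[R]_k -> R)
    (nu : 'rV[R]_k -> probability (borel R d) R) (q : 'rV[R]_k)
    (u : nat -> R) :
  (forall q, gibbs mu q (t q) (nu q)) ->
  (forall n, 0 < u n < 1) -> nonincreasing_seq u -> u n @[n --> \oo] --> 0 ->
  ln (u n.+1) / ln (u n) @[n --> \oo] --> (1 : R) ->
  (forall e, 0 < e -> (\sum_(n <oo) (powR (u n) e)%:E < +oo)%E) ->
  (forall j, derivable t q (delta_mx ord0 j)) ->
  {ae nu q, forall x, msupport mu x ->
     has_alpha mu x (- \row_j 'D_(delta_mx ord0 j) t q)}.
Proof.
move=> g u01 u_noninc u_cvg rho_cvg u_sum tdrv.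
have FF : Filter (almost_everywhere (nu q)) := ae_filter_ringOfSetsType _.
have u0 n : 0 < u n by case/andP: (u01 n).
have lnu n : ln (u n) < 0 by rewrite ln_lt0.
(* Countably many steps [s m], so that the exceptional null sets can be united.
   The deviation [s m ^+ 2] is what becomes [s m] after division by the step. *)
pose s m : R := m.+1%:R^-1.
have s0 m : 0 < s m by rewrite invr_gt0.
pose dev m j (z : R) x := \forall n \near \oo,
  z * s m * logmass mu x (u n) ord0 j <
    - (t (q + (z * s m) *: delta_mx ord0 j) - t q + s m ^+ 2) * ln (u n).
have aedev m j z : {ae nu q, forall x, msupport mu x -> dev m j z x}.
  have e0 : 0 < s m ^+ 2 / 2 by rewrite divr_gt0 ?exprn_gt0.
  apply: filterS (ae_gibbs_deviation R d k hd mu q (q + (z * s m) *: delta_mx ord0 j)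
    _ _ _ _ u _ (g q) (g _) e0 u0 u_cvg (u_sum _ e0)) => x /[apply].
  apply: filterS => n; rewrite addrC addKr dotp_delta.
  by rewrite [2 * _]mulrC divfK.
have : {ae nu q, forall x, forall m, forall j, msupport mu x -> dev m j 1 x /\ dev m j (-1) x}.
  apply: ae_foralln => m.
  apply: (@filter_forall _ 'I_k (fun j x => msupport mu x -> dev m j 1 x /\ dev m j (-1) x)
    (almost_everywhere (nu q))) => j.
  apply: filterS2 (aedev m j 1) (aedev m j (-1)) => x h1 h2 Sx.
  by split; [exact: h1|exact: h2].
apply: filterS => x devx Sx j; apply/has_local_dimE => //.
rewrite !mxE; set D := 'D__ _ _.
apply: (@cvg_ratio_of_seq _ _ u) => //.
- move=> r r' r0 rr'; rewrite !mxE ler_ln ?posrE ?msupport_fine_gt0// ?(lt_le_trans r0)//.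
  apply: fine_le; rewrite ?fin_num_measure//; try exact: measurable_eball.
  by apply: le_measure; rewrite ?inE; try exact: measurable_eball; exact: subset_eball.
- move=> r r0; rewrite mxE ln_le0// -lee_fin fineK.
    by apply: probability_le1; exact: measurable_eball.
  by rewrite fin_num_measure//; exact: measurable_eball.
apply/cvgrPdist_le => e e0.
have /cvgrPdist_le/(_ (e / 2)) := tdrv j.
rewrite divr_gt0// => /(_ isT); rewrite -/(derive _ _ _) -/D.
move=> -[del /= del0 hdel].
have [m [sdel se]] : exists m, s m < del /\ s m < e / 2.
  have [m hm] : exists m, s m < Num.min del (e / 2).
    have : 0 < Num.min del (e / 2) by rewrite lt_min del0 divr_gt0.
    move=> h; exists (Num.trunc (Num.min del (e / 2))^-1).
    rewrite /s invf_plt ?posrE//; exact: truncnS_gt.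
  by exists m; move: hm; rewrite lt_min => /andP[].
have hD (z : R) : `|z| = 1 ->
    `|D - (z * s m)^-1 * (t (q + (z * s m) *: delta_mx ord0 j) - t q)| <= e / 2.
  move=> z1; have zs : `|z * s m| = s m by rewrite normrM z1 mul1r gtr0_norm.
  have := hdel (z * s m); rewrite /ball_ /= sub0r normrN zs => /(_ sdel).
  by rewrite -normr_gt0 zs s0 => /(_ isT); rewrite [_ + q]addrC.
have [dp dm] := devx m j Sx.
have := hD 1 (normr1 _); have := hD (-1) (normrN1 _).
rewrite !ler_norml mul1r mulN1r invrN => /andP[m1 m2] /andP[p1 p2].
near=> n.
have dpn : 1 * s m * logmass mu x (u n) ord0 j <
    - (t (q + (1 * s m) *: delta_mx ord0 j) - t q + s m ^+ 2) * ln (u n).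
  by near: n.
have dmn : -1 * s m * logmass mu x (u n) ord0 j <
    - (t (q + (-1 * s m) *: delta_mx ord0 j) - t q + s m ^+ 2) * ln (u n).
  by near: n.
move: dpn dmn p1 p2 m1 m2; rewrite mul1r mulN1r.
set l := logmass _ _ _ _ _; set tp := t (q + s m *: _); set tm := t (q + - s m *: _).
move=> dpn dmn p1 p2 m1 m2.
have lE : l = l / ln (u n) * ln (u n) by rewrite divfK// lt_eqF.
move: dpn dmn; rewrite [l in X in X -> _]lE [l in X in _ -> X -> _]lE.
set v := l / ln (u n); rewrite mulNr !mulrA -mulNr !ltr_nM2r// -!mulrA -/v => dpn dmn.
have {}dpn : - ((s m)^-1 * (tp - t q) + s m) < v.
  rewrite -(ltr_pM2l (s0 m)); apply: le_lt_trans dpn.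
  by rewrite le_eqVlt; apply/orP; left; apply/eqP; field; rewrite gt_eqF.
have {}dmn : v < (s m)^-1 * (tm - t q) + s m.
  rewrite -(ltr_pM2l (s0 m)) -ltrN2; apply: le_lt_trans dmn.
  by rewrite le_eqVlt; apply/orP; left; apply/eqP; field; rewrite gt_eqF.
rewrite ler_norml; apply/andP; split; lra.
Unshelve. all: by end_near. Qed.

(** * The packing exponent [B_mu] *)

Lemma near_right_lt {R : realType} (P : set R) :
  (\forall r \near 0^'+, P r) ->
  \forall e \near 0^'+, forall r, 0 < r < e -> P r.
Proof.
move=> [e0 /= e00 Pe0]; near=> e => r /andP[r0 re].
have ee0 : e < e0 by near: e; exact: nbhs_right_lt.
by apply: Pe0 => //=; rewrite sub0r normrN gtr0_norm// (lt_trans re).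
Unshelve. all: by end_near. Qed.

Section PackingDimension.
Context {R : realType} {d k : nat} (hd : (0 < d)%N).
Context (mu : 'I_k -> probability (borel R d) R).
Context (q : 'rV[R]_k) (a : R) (nu : probability (borel R d) R).
Context (g : gibbs mu q a nu).
Local Notation S := (msupport mu).

Lemma packing_pre_eps_ge0 t e (E : set 'rV[R]_d) :
  (0 <= packing_pre_eps mu q t e E)%E.
Proof.
apply: ereal_sup_ubound; exists set0, (fun=> 0), (fun=> 0).
split; last by rewrite esum_set0.
by split => // i j [].
Qed.

Lemma packing_pre_ge0 t (E : set 'rV[R]_d) : (0 <= packing_pre mu q t E)%E.
Proof.
apply: lime_ge; last by near=> e; exact: packing_pre_eps_ge0.
apply: nondecreasing_at_right_is_cvge; near=> e => r s _ _ rs.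
apply: ereal_sup_le => _ [D [x [u [[xE tD] ->]]]]; exists D, x, u.
by split => //; split => // i /xE[? ? ur]; split => //; exact: lt_le_trans ur rs.
Unshelve. all: by end_near. Qed.

Lemma packing_term t (x : 'rV[R]_d) r : S x -> 0 < r ->
  (mupow mu (eball x r) q * (powR (2 * r) t)%:E =
   (expR (dotp q (logmass mu x r) + t * ln 2 + t * ln r))%:E)%E.
Proof.
move=> Sx r0; rewrite mupowE// -EFinM /powR gt_eqF ?mulr_gt0// -expRD.
by rewrite lnM ?posrE// mulrDr addrA.
Qed.

(** Each term of a packing sum is at most [(2 ^ t) (h ^ ((t - a) / 2))] times the
    [nu]-mass of its ball, and the balls are disjoint. *)
Lemma packing_pre_msupport t : a < t -> packing_pre mu q t S = 0%E.
Proof.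
move=> at_; have e0 : 0 < (t - a) / 2 by rewrite divr_gt0 ?subr_gt0.
set e := (t - a) / 2 in e0.
apply/cvg_lim => //; apply/fine_cvgP.
have bnd : \forall h \near 0^'+, (packing_pre_eps mu q t h S <=
    (expR (t * ln 2 + e * ln h))%:E)%E.
  near=> h; have h0 : 0 < h by near: h; exact: nbhs_right_gt.
  have gh : forall r, 0 < r < h -> gibbs_bounds mu q a nu e r.
    by near: h; apply: near_right_lt; exact: g.
  apply: ge_ereal_sup => _ [D [x [r [[xP tD] ->]]]].
  apply: (packing_esum_le nu _ x r); rewrite ?expR_ge0// => i /xP[Sx r0 rh].
  have /andP[h1 _] := gh _ (introT andP (conj r0 rh)) _ Sx.
  rewrite packing_term//; apply: le_trans (lee_wpmul2l _ h1); last first.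
    by rewrite lee_fin expR_ge0.
  rewrite -EFinM lee_fin -expRD ler_expR.
  have : e * ln (r i) <= e * ln h by rewrite ler_pM2l// ler_ln ?posrE// ltW.
  by rewrite /e => ?; lra.
have fin : \forall h \near 0^'+, packing_pre_eps mu q t h S \is a fin_num.
  apply: filterS bnd => h hb; rewrite ge0_fin_numE ?packing_pre_eps_ge0//.
  by apply: le_lt_trans hb _; rewrite ltry.
split => //; apply/cvgrPdist_le => eta eta0; near=> h.
have hf : packing_pre_eps mu q t h S \is a fin_num by near: h; exact: fin.
rewrite /= sub0r normrN ger0_norm ?fine_ge0 ?packing_pre_eps_ge0//.
rewrite -lee_fin fineK//.
have hb : (packing_pre_eps mu q t h S <= (expR (t * ln 2 + e * ln h))%:E)%E.
  by near: h; exact: bnd.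
apply: le_trans hb _; rewrite lee_fin -[leRHS]lnK// ler_expR.
have : ln h < (ln eta - t * ln 2) / e by near: h; exact: near_ln_lt.
by rewrite ltr_pdivlMr// => ?; lra.
Unshelve. all: by end_near. Qed.

Lemma packing_measure_eq0 t : a < t -> packing_measure mu q t S = 0%E.
Proof.
move=> at_; apply/eqP; rewrite eq_le; apply/andP; split.
  apply: ereal_inf_lbound; exists (fun=> S); first by move=> x Sx; exists 0%N.
  (* All the sets of the cover may be the whole support, since 0 is summed. *)
  by rewrite eseries0// => i _ _; exact: packing_pre_msupport.
apply: le_ereal_inf_tmp => _ [F _ <-].
by apply: nneseries_ge0 => i _ _; exact: packing_pre_ge0.
Qed.

(** If the packing sums of [E] at scale [h] were bounded by [M], then the [nu]-mass
    of a grid cover by balls of radius [r] would be at most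
    [#|C| (2 ^ - t) (r ^ ((a - t) / 2)) M], which tends to 0 with [r], whereas
    these balls cover a set of positive mass. *)
Lemma packing_pre_pinfty t (E : set 'rV[R]_d) :
  t < a -> (0 < nu (closure (E `&` S)))%E -> packing_pre mu q t E = +oo%E.
Proof.
move=> ta nuE; have e0 : 0 < (a - t) / 2 by rewrite divr_gt0 ?subr_gt0.
set e := (a - t) / 2 in e0.
apply: lim_near_cst => //; near=> h; have h0 : 0 < h by near: h; exact: nbhs_right_gt.
apply: contrapT => hnoo; have hfin : packing_pre_eps mu q t h E \is a fin_num.
  by rewrite ge0_fin_numE ?packing_pre_eps_ge0// ltey; apply/eqP.
set M := fine (packing_pre_eps mu q t h E).
have M0 : 0 <= M by rewrite fine_ge0 ?packing_pre_eps_ge0.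
have [C grid] := grid_packing R d hd.
have mcl : measurable (closure (E `&` S) : set (borel R d)).
  by apply: closed_borel; exact: closed_closure.
have [z z0 zE] : exists2 z : R, 0 < z & nu (closure (E `&` S)) = z%:E.
  exists (fine (nu (closure (E `&` S)))); last by rewrite fineK ?fin_num_measure.
  by rewrite fine_gt0// nuE ltey_eq fin_num_measure.
have [r [r0 rh gr rsmall]] : exists r, [/\ 0 < r, r < h, gibbs_bounds mu q a nu e r &
    ln r < (ln (z / (#|C|.+1%:R * (M + 1))) + t * ln 2) / e].
  apply: (@filter_ex _ (0^'+)); near=> r; split; near: r.
  - exact: nbhs_right_gt.
  - exact: nbhs_right_lt.
  - exact: g.
  - exact: near_ln_lt.
have [x [D [col [DE tD ED]]]] := grid (E `&` S) r r0.
pose c := expR (e * ln r - t * ln 2).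
have mB i : measurable (eball (x i) r : set (borel R d)) by exact: measurable_eball.
have : (nu (closure (E `&` S)) <= (#|C|%:R * (c * M))%:E)%E.
  apply: (le_trans (cover_esum nu _ D (fun i => eball (x i) r) mcl mB ED)).
  apply: (@esum_colored_le _ _ _ col) => // j.
  apply: (@le_trans _ _ (c%:E * \esum_(i in D `&` [set i | col i = j])
    (mupow mu (eball (x i) r) q * (powR (2 * r) t)%:E))%E).
    rewrite -esumZl ?expR_ge0//; last first.
      by move=> i [/DE[_ Sx] _]; rewrite packing_term// lee_fin expR_ge0.
    apply: le_esum => i [/DE[_ Sx] _]; rewrite packing_term//.
    have /andP[_ h1] := gr _ Sx; apply: le_trans h1 _.
    by rewrite -EFinM lee_fin -expRD ler_expR /e; lra.
  rewrite EFinM lee_wpmul2l ?lee_fin ?expR_ge0// fineK//.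
  apply: ereal_sup_ubound; exists (D `&` [set i | col i = j]), x, (fun=> r).
  by split => //; split => // i [/DE[Ex _] _].
rewrite zE lee_fin; apply/negP; rewrite -ltNge.
have C0 : 0 < #|C|.+1%:R * (M + 1) :> R by rewrite mulr_gt0// ltr_wpDl.
have cz : c < z / (#|C|.+1%:R * (M + 1)).
  rewrite -[ltRHS]lnK ?posrE ?divr_gt0// ltr_expR.
  by move: rsmall; rewrite ltr_pdivlMr// => ?; lra.
move: cz; rewrite ltr_pdivlMr//; apply: le_lt_trans.
rewrite mulrCA ler_pM2l ?expR_gt0// ler_pM//.
  by rewrite ler_nat.
by rewrite lerDl.
Unshelve. all: by end_near. Qed.

(** The pieces [F i] of a cover need not be measurable, but the closures of their
    traces on the support are, and one of them has positive mass. *)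
Lemma packing_measure_pinfty t : nu S = 1%E ->
  t < a -> packing_measure mu q t S = +oo%E.
Proof.
move=> nuS ta; apply/ereal_inf_pinfty => _ [F SF <-] /=.
have mcl i : measurable (closure (F i `&` S) : set (borel R d)).
  by apply: closed_borel; exact: closed_closure.
have [i nui] : exists i, (0 < nu (closure (F i `&` S)))%E.
  apply: contrapT => /forallNP n0.
  have : (nu S <= \sum_(i <oo) nu (closure (F i `&` S)))%E.
    apply: measure_sigma_subadditive => //; first exact: measurable_msupport.
    by move=> x Sx; have [i _ Fx] := SF _ Sx; exists i => //; exact: subset_closure.
  rewrite nuS eseries0; first by rewrite leNgt lte01.
  by move=> i _ _; apply/eqP; rewrite eq_le measure_ge0 leNgt andbT; apply/negP/n0.
apply: (@nneseries_pinfty _ _ _ i) => //.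
  by move=> n _; exact: packing_pre_ge0.
exact: packing_pre_pinfty.
Qed.

(** By [packing_measure_eq0] and [packing_measure_pinfty], [a] has the property
    that defines [B_mu mu q]; no other number has it, as the packing measure at
    an exponent strictly between the two would be both [+oo] and 0. *)
Lemma B_muE : nu S = 1%E -> B_mu mu q = a%:E.
Proof.
move=> nuS; rewrite /B_mu; set P := [set b | _].
have Pa : P a%:E.
  move=> t; rewrite !lte_fin; split; last exact: packing_measure_eq0.
  exact: packing_measure_pinfty.
move: (getI Pa); set b := LHS => /= Pg.
apply/eqP; case: ltgtP => //= [ltg|ltg].
- have [t [/(Pg _).2 t1 /(Pa _).1 t2]] : exists t, (b < t%:E)%E /\ (t%:E < a%:E)%E.
    move: ltg; case: b {Pg} => [b|//|_].
    + by rewrite lte_fin => ba; exists ((a + b) / 2); rewrite !lte_fin; split; lra.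
    + by exists (a - 1); rewrite ltNyr lte_fin; split => //; lra.
  by rewrite t2 in t1.
- have [t [/(Pa _).2 t1 /(Pg _).1 t2]] : exists t, (a%:E < t%:E)%E /\ (t%:E < b)%E.
    move: ltg; case: b {Pg} => [b|_|//].
    + by rewrite lte_fin => ba; exists ((a + b) / 2); rewrite !lte_fin; split; lra.
    + by exists (a + 1); rewrite ltry lte_fin; split => //; lra.
  by rewrite t2 in t1.
Qed.

End PackingDimension.

(** * Hausdorff premeasures *)

Section HausdorffBasics.
Context {R : realType} {d : nat}.
Implicit Types (E : set 'rV[R]_d) (U : set 'rV[R]_d).

Lemma diam_pow_ge0 s U : (0 <= diam_pow s U)%E.
Proof. by rewrite /diam_pow; case: ifPn => // _; exact: poweR_ge0. Qed.

Lemma hausdorff_pre_ge0 s delta E : (0 <= hausdorff_pre s delta E)%E.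
Proof.
apply: le_ereal_inf_tmp => _ [U _ <-].
by apply: nneseries_ge0 => i _ _; exact: diam_pow_ge0.
Qed.

Lemma hausdorff_pre_subset s delta E F : E `<=` F ->
  (hausdorff_pre s delta E <= hausdorff_pre s delta F)%E.
Proof.
move=> EF; apply: ereal_inf_le_tmp => _ [U [FU dU] <-].
by exists U => //; split => //; exact: subset_trans FU.
Qed.

(** [hausdorff_pre s delta E] increases when [delta] decreases to 0. *)
Lemma hausdorff_pre_le_measure s delta E : 0 < delta ->
  (hausdorff_pre s delta E <= hausdorff_measure s E)%E.
Proof.
move=> delta0.
have mono r r' : r <= r' -> (hausdorff_pre s r' E <= hausdorff_pre s r E)%E.
  move=> rr'; apply: ereal_inf_le_tmp => _ [U [EU dU] <-].
  exists U => //; split => // i; apply: le_trans (dU i) _.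
  by rewrite lee_fin.
apply: lime_ge.
  apply: nonincreasing_at_right_is_cvge; near=> e => r r' _ _.
  exact: mono.
near=> e; apply: mono; near: e; exact: nbhs_right_le.
Unshelve. all: by end_near. Qed.

Lemma hausdorff_pre_bigcup0 s delta (F : nat -> set 'rV[R]_d) :
  (forall n, hausdorff_pre s delta (F n) = 0%E) ->
  hausdorff_pre s delta (\bigcup_n F n) = 0%E.
Proof.
move=> F0; apply/eqP; rewrite eq_le hausdorff_pre_ge0 andbT.
apply/lee_addgt0Pr => e e0; rewrite add0e.
have /choice[G GP] : forall n, exists U : nat -> set 'rV[R]_d,
    [/\ F n `<=` \bigcup_i U i, forall i, (ediam (U i) <= delta%:E)%E &
        (\sum_(i <oo) diam_pow s (U i) <= (e / (2 ^ n.+1)%:R)%:E)%E].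
  move=> n; have : (hausdorff_pre s delta (F n) < (e / (2 ^ n.+1)%:R)%:E)%E.
    by rewrite F0 lte_fin divr_gt0// ltr0n expn_gt0.
  by move=> /ereal_inf_lt[_ [U [FU dU] <-] /ltW sU]; exists U.
have /card_esym/ppcard_eqP[f] := card_nat2.
apply: le_trans (epsilon_trick0 xpredT (ltW e0)).
apply: (@le_trans _ _ (\sum_(m <oo) diam_pow s (G (f m).1 (f m).2))%E).
  apply: ereal_inf_lbound; exists (fun m => G (f m).1 (f m).2) => //; split.
    move=> x [n _ Fx]; have [FG _ _] := GP n; have [i _ Gx] := FG _ Fx.
    by exists (f^-1%FUN (n, i)) => //=; rewrite invK ?inE.
  by move=> m; have [_ + _] := GP (f m).1; apply.
rewrite nneseries_esumT; last by move=> m; exact: diam_pow_ge0.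
rewrite -(@reindex_esum _ _ _ setT setT f (fun p => diam_pow s (G p.1 p.2))); last exact: 'bij_f.
rewrite (_ : setT = setT `*`` (fun=> setT)); last by apply/seteqP; split.
rewrite -(@esum_esum _ _ _ _ _ (fun i j => diam_pow s (G i j))); last first.
  by move=> i j _ _; exact: diam_pow_ge0.
rewrite nneseries_esumT; last first.
  by move=> n; rewrite lee_fin divr_ge0// ltW.
apply: le_esum => n _; rewrite -nneseries_esumT; last by move=> m; exact: diam_pow_ge0.
by have [] := GP n.
Qed.

End HausdorffBasics.

(** * Dimension of the level sets *)

Lemma near_right_archi {R : realType} (P : set R) :
  (\forall r \near 0^'+, P r) ->
  exists n : nat, forall r, 0 < r < n.+1%:R^-1 -> P r.
Proof.
move=> [e /= e0 Pe]; exists (Num.trunc e^-1) => r /andP[r0 rn].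
apply: Pe => //=; rewrite sub0r normrN gtr0_norm// (lt_trans rn)//.
by rewrite invf_plt ?posrE// truncnS_gt.
Qed.

Lemma ediam_eball {R : realType} {d} (x : 'rV[R]_d) (r : R) :
  (ediam (eball x r) <= (d%:R * (2 * r))%:E)%E.
Proof.
apply: ge_ereal_sup => _ [[y z] [/= xy xz] <-]; rewrite lee_fin.
apply: enorm_le_coord => i; rewrite !mxE.
have := le_trans (coord_le_enorm _ i) xy; rewrite !mxE => {}xy.
have := le_trans (coord_le_enorm _ i) xz; rewrite !mxE => {}xz.
rewrite (_ : y ord0 i - _ = (y ord0 i - x ord0 i) - (z ord0 i - x ord0 i)); last by ring.
by rewrite (le_trans (ler_normB _ _))// mulr_natl mulr2n lerD.
Qed.

Lemma ediam_ge {R : realType} {d} (U : set 'rV[R]_d) y z :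
  U y -> U z -> ((enorm (y - z))%:E <= ediam U)%E.
Proof. by move=> Uy Uz; apply: ereal_sup_ubound; exists (y, z). Qed.

Lemma diam_pow_eball {R : realType} {d} (x : 'rV[R]_d) (s r : R) : 0 <= s ->
  0 < r -> (diam_pow s (eball x r) <= (powR (d%:R * (2 * r)) s)%:E)%E.
Proof.
move=> s0 r0; rewrite /diam_pow; case: ifPn => [_|_]; first by rewrite lee_fin powR_ge0.
have xx : eball x r x by apply: eball_center; exact: ltW.
have h0 : (0 <= ediam (eball x r))%E.
  by apply: le_trans (ediam_ge _ _ _ xx xx); rewrite lee_fin enorm_ge0.
rewrite -poweR_EFin; apply: gt0_ler_poweR => //.
- by rewrite in_itv /= h0 leey.
- by rewrite in_itv /= leey andbT lee_fin mulr_ge0 ?mulr_ge0// ltW.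
- exact: ediam_eball.
Qed.

Section Spectrum.
Context {R : realType} {d k : nat} (hd : (0 < d)%N).
Context (mu : 'I_k -> probability (borel R d) R).
Context (q alpha : 'rV[R]_k) (a : R) (nu : probability (borel R d) R).
Context (g : gibbs mu q a nu).

Lemma Xset_logmass x e : Xset mu alpha x -> 0 < e ->
  \forall r \near 0^'+, (dotp alpha q + e) * ln r <= dotp q (logmass mu x r)
     <= (dotp alpha q - e) * ln r.
Proof.
move=> [Sx ax] e0.
have : dotp q (logmass mu x r) / ln r @[r --> 0^'+] --> dotp alpha q.
  rewrite (_ : (fun r => _) = (fun r => \sum_(j < k) q ord0 j * (logmass mu x r ord0 j / ln r))).
    rewrite /dotp; elim: (index_enum _) => [|j s IH].
      under eq_fun do rewrite big_nil.
      by rewrite big_nil; exact: cvg_cst.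
    under eq_fun do rewrite big_cons.
    rewrite big_cons; apply: cvgD; last exact: IH.
    rewrite [alpha _ _ * _]mulrC; apply: cvgM; first exact: cvg_cst.
    by apply/has_local_dimE => //; exact: ax.
  by apply/funext => r; rewrite /dotp mulr_suml; apply: eq_bigr => j _; rewrite mulrA.
move=> /cvgrPdist_le/(_ e e0) h; near=> r.
have lnr : ln r < 0 by near: r; exact: near_ln_lt.
have : `|dotp alpha q - dotp q (logmass mu x r) / ln r| <= e by near: r; exact: h.
rewrite ler_norml => /andP[h1 h2]; rewrite -ler_ndivlMr// -ler_ndivrMr//.
by apply/andP; split; lra.
Unshelve. all: by end_near. Qed.

(** [log mu(B)^q / log r] tends to [dotp alpha q] on the level set, where [nu] has
    therefore local dimension [dotp alpha q + a]. *)
Lemma Xset_gibbs x e : Xset mu alpha x -> 0 < e ->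
  \forall r \near 0^'+, ((expR ((dotp alpha q + a + e) * ln r))%:E
    <= nu (eball x r) <= (expR ((dotp alpha q + a - e) * ln r))%:E)%E.
Proof.
move=> Xx e0; have e20 : 0 < e / 2 by rewrite divr_gt0.
near=> r.
have gr : gibbs_bounds mu q a nu (e / 2) r by near: r; exact: g.
have /andP[l1 l2] : (dotp alpha q + e / 2) * ln r <= dotp q (logmass mu x r)
     <= (dotp alpha q - e / 2) * ln r by near: r; exact: Xset_logmass.
have /andP[g1 g2] := gr _ Xx.1; apply/andP; split.
- by apply: le_trans g1; rewrite lee_fin ler_expR; lra.
- by apply: le_trans g2 _; rewrite lee_fin ler_expR; lra.
Unshelve. all: by end_near. Qed.

(** Otherwise [nu] would give small balls around [x] a mass larger than 1. *)
Lemma Xset_exponent_ge0 x : Xset mu alpha x -> 0 <= dotp alpha q + a.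
Proof.
move=> Xx; rewrite leNgt; apply/negP => D0.
have e0 : 0 < - (dotp alpha q + a) / 2 by rewrite divr_gt0// oppr_gt0.
have [r [r0 lnr h]] : exists r, [/\ 0 < r, ln r < 0 &
    ((expR ((dotp alpha q + a + - (dotp alpha q + a) / 2) * ln r))%:E <= nu (eball x r))%E].
  apply: (@filter_ex _ (0^'+)); near=> r; split; near: r.
  - exact: nbhs_right_gt.
  - exact: near_ln_lt.
  - by apply: filterS (Xset_gibbs _ _ Xx e0) => r /andP[].
have := le_trans h (probability_le1 nu (measurable_eball x r)).
rewrite lee_fin -[leRHS]expR0 ler_expR leNgt nmulr_lgt0//.
rewrite (_ : _ + _ = (dotp alpha q + a) / 2); last by lra.
by rewrite pmulr_llt0 ?invr_gt0// D0.
Unshelve. all: by end_near. Qed.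

(** Cover [X] by balls of small radius [r] centred in [X], which form boundedly
    many packings. Each ball contributes about [r ^ s = r ^ e r ^ (s - e)], at most
    [r ^ e] times its [nu]-mass, so that the sum is of order [r ^ e]. *)
Lemma hausdorff_pre_uniform0 s delta n (X : set 'rV[R]_d) (e : R) :
  0 <= s -> 0 < e -> 0 < delta ->
  (forall x r, X x -> 0 < r < n.+1%:R^-1 ->
     ((expR ((s - e) * ln r))%:E <= nu (eball x r))%E) ->
  hausdorff_pre s delta X = 0%E.
Proof.
move=> s0 e0 delta0 Xnu.
have [C grid] := grid_packing R d hd.
apply/eqP; rewrite eq_le hausdorff_pre_ge0 andbT.
apply/lee_addgt0Pr => eta eta0; rewrite add0e.
have d0 : 0 < d%:R :> R by rewrite ltr0n.
have C0 : 0 < #|C|.+1%:R :> R by rewrite ltr0n.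
have [r [r0 rn rdelta rsmall]] : exists r, [/\ 0 < r, r < n.+1%:R^-1,
    r <= delta / (d%:R * 2) & ln r < (ln (eta / #|C|.+1%:R) - s * ln (d%:R * 2)) / e].
  apply: (@filter_ex _ (0^'+)); near=> r; split; near: r.
  - exact: nbhs_right_gt.
  - by apply: nbhs_right_lt; rewrite invr_gt0.
  - by apply: nbhs_right_le; rewrite divr_gt0// mulr_gt0.
  - exact: near_ln_lt.
have [x [D [col [DX tD XD]]]] := grid X r r0.
pose U i := if i \in D then eball (x i) r else set0.
apply: (@le_trans _ _ (\sum_(i <oo) diam_pow s (U i))%E).
  apply: ereal_inf_lbound; exists U => //; split.
    move=> y /subset_closure/XD[i Di yi]; exists i => //.
    by rewrite /U mem_set.
  move=> i; rewrite /U; case: ifPn => _.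
    apply: le_trans (ediam_eball _ _) _; rewrite lee_fin mulrA mulrC.
    by rewrite -ler_pdivlMr ?mulr_gt0.
  rewrite (_ : ediam set0 = -oo%E) ?leNye//.
  by rewrite /ediam (_ : [set _ | _ in _] = set0) ?ereal_sup0// -subset0 => _ [[? ?] [[]]].
rewrite nneseries_esumT; last by move=> i; exact: diam_pow_ge0.
rewrite (_ : \esum_(i in _) _ = \esum_(i in D) diam_pow s (eball (x i) r))%E; last first.
  rewrite [RHS]esum_mkcond; apply: eq_esum => i _; rewrite /U; case: ifPn => // _.
  by rewrite /diam_pow eqxx.
pose c := expR (s * ln (d%:R * 2) + e * ln r).
apply: (@le_trans _ _ (#|C|%:R * c)%:E).
  apply: (@esum_colored_le _ _ _ col) => [i _|j]; first exact: diam_pow_ge0.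
  apply: (packing_esum_le nu _ x (fun=> r)); rewrite ?expR_ge0// => i [/DX Xi _].
  apply: le_trans (diam_pow_eball _ _ _ s0 r0) _.
  have := Xnu _ _ Xi (introT andP (conj r0 rn)) => h.
  apply: le_trans (lee_wpmul2l _ h); last by rewrite lee_fin expR_ge0.
  rewrite -EFinM lee_fin -expRD /powR gt_eqF ?mulr_gt0// ler_expR mulrA lnM ?posrE ?mulr_gt0//.
  by rewrite le_eqVlt; apply/orP; left; apply/eqP; ring.
rewrite lee_fin; apply: (@le_trans _ _ (#|C|.+1%:R * c)).
  by rewrite ler_wpM2r ?expR_ge0// ler_nat.
rewrite mulrC -ler_pdivlMr// -[leRHS]lnK ?posrE ?divr_gt0// ler_expR.
by move: rsmall; rewrite ltr_pdivlMr// => ?; lra.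
Unshelve. all: by end_near. Qed.

(** The lower bound on [nu (eball x r)] holds for radii that depend on [x]; the
    level set is therefore cut into countably many pieces on which it holds
    uniformly. Nonemptiness makes the candidate dimension nonnegative, as the
    exponents admitted in [hausdorff_dim] are. *)
Lemma hausdorff_dim_Xset_le : Xset mu alpha !=set0 ->
  (hausdorff_dim (Xset mu alpha) <= (dotp alpha q + a)%:E)%E.
Proof.
move=> [x0 Xx0]; have D0 := Xset_exponent_ge0 _ Xx0.
apply/lee_addgt0Pr => e e0; rewrite -EFinD.
have s0 : 0 <= dotp alpha q + a + e by rewrite addr_ge0// ltW.
apply: ereal_inf_lbound; exists (dotp alpha q + a + e) => //; split => //.
have e20 : 0 < e / 2 by rewrite divr_gt0.
apply: lim_near_cst => //; near=> delta.
have delta0 : 0 < delta by near: delta; exact: nbhs_right_gt.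
pose X n := [set x | forall r, 0 < r < n.+1%:R^-1 ->
  ((expR ((dotp alpha q + a + e / 2) * ln r))%:E <= nu (eball x r))%E].
apply/eqP; rewrite eq_le hausdorff_pre_ge0 andbT.
apply: (@le_trans _ _ (hausdorff_pre (dotp alpha q + a + e) delta (\bigcup_n X n))).
  apply: hausdorff_pre_subset => x Xx.
  have [n hn] := near_right_archi _ (Xset_gibbs _ _ Xx e20).
  by exists n => // r /hn/andP[].
rewrite hausdorff_pre_bigcup0// => n.
apply: (hausdorff_pre_uniform0 _ _ n _ (e / 2)) => // x r Xx rn.
rewrite (_ : _ - _ = dotp alpha q + a + e / 2); last by lra.
exact: Xx.
Unshelve. all: by end_near. Qed.

(** Mass distribution principle. A set [U] of a cover that meets [A] lies, as
    far as [A] is concerned, in the ball around a point of [A] with radius the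
    diameter of [U], whose mass is at most [diam_pow s U]. Covers with small
    sums thus give measurable hulls of [A] of small mass. *)
Lemma mass_distribution s s' delta n (A : set 'rV[R]_d) :
  0 <= s -> s <= s' -> 0 < s' -> 0 < delta < n.+1%:R^-1 ->
  (forall x r, A x -> 0 < r < n.+1%:R^-1 ->
     (nu (eball x r) <= (expR (s' * ln r))%:E)%E) ->
  hausdorff_pre s delta A = 0%E -> nu.-negligible A.
Proof.
move=> s0 ss' s'0 /andP[delta0 deltan] Anu H0.
have delta1 : delta < 1.
  by apply: lt_le_trans deltan _; rewrite invf_le1// ler1n.
have cover m : exists G : set (borel R d), [/\ measurable G, A `<=` G &
    (nu G <= (m.+1%:R^-1)%:E)%E].
  have : (hausdorff_pre s delta A < (m.+1%:R^-1)%:E)%E.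
    by rewrite H0 lte_fin invr_gt0.
  move=> /ereal_inf_lt[_ [U [AU dU] <-] /ltW sU].
  pose c i := xget 0 (U i `&` A).
  pose V i : set 'rV[R]_d :=
    if U i `&` A == set0 then set0 else eball (c i) (fine (ediam (U i))).
  have mV i : measurable (V i : set (borel R d)).
    by rewrite /V; case: ifPn => _; [exact: measurable0|exact: measurable_eball].
  have cP i : U i `&` A != set0 -> U i (c i) /\ A (c i).
    by move=> /set0P[y UAy]; exact: (@xgetPex _ 0 (U i `&` A)) (ex_intro _ y UAy).
  have dfin i : U i `&` A != set0 -> (0 <= ediam (U i))%E /\ ediam (U i) \is a fin_num.
    move=> /cP[Uc _]; have h : (0 <= ediam (U i))%E.
      by apply: le_trans (ediam_ge _ _ _ Uc Uc); rewrite lee_fin enorm_ge0.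
    by split => //; rewrite ge0_fin_numE//; apply: le_lt_trans (dU i) (ltry _).
  exists (\bigcup_i V i); split; first exact: bigcup_measurable.
    move=> y Ay; have [i _ Uy] := AU _ Ay; exists i => //.
    have UA : U i `&` A != set0 by apply/set0P; exists y.
    rewrite /V (negbTE UA) /eball /= -lee_fin fineK; last by have [] := dfin _ UA.
    by apply: ediam_ge => //; have [] := cP _ UA.
  apply: le_trans sU.
  apply: le_trans (measure_sigma_subadditive nu mV
    (bigcup_measurable (fun i _ => mV i)) (@subset_refl _ _)) _.
  apply: lee_nneseries => // i _; rewrite /V; case: ifPn => [_|UA].
    by rewrite measure0 diam_pow_ge0.
  have [Uc Ac] := cP _ UA; have [h0 hfin] := dfin _ UA.
  rewrite /diam_pow ifF; last by apply/negP => /eqP U0; rewrite U0 in Uc.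
  have dmd : fine (ediam (U i)) <= delta by rewrite -lee_fin fineK.
  have dm0 : 0 <= fine (ediam (U i)) by exact: fine_ge0.
  rewrite -[in leRHS](fineK hfin) poweR_EFin; move: dm0 dmd.
  move: (fine _) => dm; rewrite le_eqVlt => /predU1P[<- _|dm0 dmd].
    (* A set of diameter 0 is a point, which has no mass: the hypothesis bears on
       positive radii, so that smaller and smaller balls are needed here. *)
    apply: (@le_trans _ _ 0%E); last by rewrite lee_fin powR_ge0.
    apply/lee_addgt0Pr => eta eta0; rewrite add0e.
    have [r [r0 rn rsmall]] : exists r, [/\ 0 < r, r < n.+1%:R^-1 & ln r < ln eta / s'].
      apply: (@filter_ex _ (0^'+)); near=> r; split; near: r.
      - exact: nbhs_right_gt.
      - by apply: nbhs_right_lt; rewrite invr_gt0.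
      - exact: near_ln_lt.
    apply: (@le_trans _ _ (nu (eball (c i) r))).
      apply: le_measure; rewrite ?inE; try exact: measurable_eball.
      by apply: subset_eball; exact: ltW.
    apply: le_trans (Anu _ _ Ac (introT andP (conj r0 rn))) _.
    rewrite lee_fin -[leRHS]lnK// ler_expR mulrC -ler_pdivlMr//.
    exact: ltW.
  apply: le_trans (Anu _ _ Ac _) _; first by rewrite dm0 (le_lt_trans dmd).
  rewrite lee_fin /powR gt_eqF// ler_expR ler_wnM2r//.
  by rewrite ln_le0// (le_trans dmd)// ltW.
have /choice[G GP] := cover.
have mG : measurable (\bigcap_m G m : set (borel R d)).
  by apply: bigcap_measurable => // m _; have [] := GP m.
exists (\bigcap_m G m); split => //; last first.
  by move=> y Ay m _; have [_ AG _] := GP m; exact: AG.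
apply/eqP; rewrite eq_le measure_ge0 andbT; apply/lee_addgt0Pr => e e0.
rewrite add0e; have [m me] : exists m, m.+1%:R^-1 <= e.
  by exists (Num.trunc e^-1); rewrite invf_ple ?posrE// ltW// truncnS_gt.
have [mGm _ nuG] := GP m.
apply: (@le_trans _ _ (nu (G m))).
  by apply: le_measure; rewrite ?inE//; exact: bigcap_inf.
by apply: le_trans nuG _; rewrite lee_fin.
Unshelve. all: by end_near. Qed.

(** If some [s] below the local dimension of [nu] had a vanishing Hausdorff
    measure, the mass distribution principle with [s'] halfway would make
    negligible each of the countably many pieces where the upper bound on
    [nu (eball x r)] is uniform, while together they carry [nu]. *)
Lemma hausdorff_dim_Xset_ge : {ae nu, forall x, Xset mu alpha x} ->
  ((dotp alpha q + a)%:E <= hausdorff_dim (Xset mu alpha))%E.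
Proof.
move=> aeX; apply: le_ereal_inf_tmp => _ [s [s0 Hs] <-].
rewrite leNgt; apply/negP; rewrite lte_fin => sD.
pose e := (dotp alpha q + a - s) / 2.
have e0 : 0 < e by rewrite divr_gt0// subr_gt0.
pose s' := dotp alpha q + a - e.
have ss' : s < s' by rewrite /s' /e; lra.
pose X n := [set x | Xset mu alpha x /\ forall r, 0 < r < n.+1%:R^-1 ->
  (nu (eball x r) <= (expR (s' * ln r))%:E)%E].
have negX : nu.-negligible (\bigcup_n X n).
  apply: negligible_bigcup => n.
  have n0 : 0 < n.+1%:R^-1 :> R by rewrite invr_gt0.
  apply: (mass_distribution s s' (n.+1%:R^-1 / 2) n) => //.
  - exact: ltW.
  - exact: le_lt_trans ss'.
  - by rewrite divr_gt0//= ltr_pdivrMr// ltr_pMr// ltr1n.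
  - by move=> x r [_ h] /h.
  apply/eqP; rewrite eq_le hausdorff_pre_ge0 andbT -Hs.
  have h : 0 < n.+1%:R^-1 / 2 :> R by rewrite divr_gt0.
  apply: le_trans (hausdorff_pre_le_measure s _ (Xset mu alpha) h).
  by apply: hausdorff_pre_subset => x [].
have nu0 : (0 < nu setT)%E by rewrite probability_setT.
have PF := @ae_properfilter_algebraOfSetsType _ _ _ _ nu0.
have : {ae nu, forall x : 'rV[R]_d, False}.
  have FF : Filter (almost_everywhere nu) := ae_filter_ringOfSetsType _.
  have aeN : {ae nu, forall x, (~` \bigcup_n X n) x}.
    by move: negX; rewrite -[X in nu.-negligible X]setCK.
  apply: filterS2 aeX aeN => x Xx; apply.
  have [n hn] := near_right_archi _ (Xset_gibbs _ _ Xx e0).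
  by exists n => //; split => // r /hn/andP[].
by move=> /filter_ex[].
Qed.

End Spectrum.

(** * The multifractal formalism *)

Lemma ae_of_full_measure {R : realType} {d} (nu : probability (borel R d) R)
    (A : set 'rV[R]_d) :
  measurable (A : set (borel R d)) -> nu A = 1%E -> {ae nu, forall x, A x}.
Proof.
move=> mA nuA; exists (~` A); split => //; first exact: measurableC.
by rewrite probability_setC// nuA subee.
Qed.

Local Open Scope ereal_scope.

Theorem theorem6p2 (R : realType) (d k : nat) (hd : (0 < d)%N) (hk : (0 < k)%N)
  (mu : 'I_k -> probability (borel R d) R)
  (t r0 Klow Kup : 'rV[R]_k -> R)
  (nu : 'rV[R]_k -> probability (borel R d) R)
  (phi : 'rV[R]_k -> R -> R)
  (rn : 'rV[R]_k -> nat -> R)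
  (r0_gt0 : forall q, (0 < r0 q)%R)
  (K_gt0 : forall q, (0 < Klow q)%R /\ (0 < Kup q)%R)
  (nu_supp : forall q, nu q (msupport mu) = 1)
  (phi_o : forall q, phi q =o_ (0^'+) (@ln R))
  (rn_01 : forall q n, (0 < rn q n < 1)%R)
  (rn_decr : forall q, nonincreasing_seq (rn q))
  (rn_cvg0 : forall q, rn q n @[n --> \oo] --> (0%R : R))
  (rn_ratio : forall q, (ln (rn q n.+1) / ln (rn q n))%R @[n --> \oo] --> (1%R : R))
  (rn_summable : forall q (e : R), (0 < e)%R ->
     \sum_(n <oo) (powR (rn q n) e)%:E < +oo)
  (A1 : forall q x (r : R), msupport mu x -> (0 < r < r0 q)%R ->
     (Klow q)%:E <=
       nu q (eball x r) /
         (mupow mu (eball x r) q * (powR (2 * r) (t q))%:E * (expR (phi q r))%:E)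
     <= (Kup q)%:E)
  (A2 : forall q p, exists C : R,
     ((- ln (rn q n))^-1)%:E *
       lne (\int[nu q]_(x in msupport mu) mupow mu (eball x (rn q n)) p)
     @[n --> \oo] --> C%:E) :
  (forall q, ediff (B_mu mu) q ->
     {ae nu q, forall x, has_alpha mu x (- egrad (B_mu mu) q)%R}) /\
  grad_dom (B_mu mu) `<=` alpha_image mu /\
  (forall alpha, grad_dom (B_mu mu) alpha ->
     f_mu mu alpha = legendre (B_mu mu) alpha).
Proof.
have g q : gibbs mu q (t q) (nu q).
  have [Kl Ku] := K_gt0 q.
  exact: (gibbs_of_bounds _ _ _ (r0 q) (Klow q) (Kup q) (phi q)) (A1 q).
have BE q : B_mu mu q = (t q)%:E by exact: (B_muE hd mu q _ _ (g q)) (nu_supp q).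
have fB : (fun q => fine (B_mu mu q)) = t by apply/funext => q; rewrite BE.
have aeX q : ediff (B_mu mu) q ->
    {ae nu q, forall x, Xset mu (- egrad (B_mu mu) q)%R x}.
  move=> [_]; rewrite fB => dt.
  have FF : Filter (almost_everywhere (nu q)) := ae_filter_ringOfSetsType _.
  have aeS := ae_of_full_measure _ _ (measurable_msupport hd mu) (nu_supp q).
  have := ae_has_alpha hd mu t nu q (rn q) g (rn_01 q) (rn_decr q) (rn_cvg0 q)
    (rn_ratio q) (rn_summable q) (fun j => diff_derivable dt).
  apply: filterS2 aeS => x Sx /(_ Sx) ax; split => //.
  by rewrite /egrad fB.
have neX q : ediff (B_mu mu) q -> Xset mu (- egrad (B_mu mu) q)%R !=set0.
  move=> /aeX; have nu0 : 0 < nu q setT by rewrite probability_setT.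
  have PF := @ae_properfilter_algebraOfSetsType _ _ _ _ nu0.
  by move=> /filter_ex[x Xx]; exists x.
split; last split.
- move=> q /aeX; have FF := ae_filter_ringOfSetsType (nu q).
  by apply: filterS => x [].
- by move=> _ [q dq <-]; have [x [Sx ax]] := neX q dq; exists x.
- move=> _ [q dq <-]; set alpha := (- _)%R.
  apply/eqP; rewrite eq_le; apply/andP; split.
    apply: le_ereal_inf_tmp => _ [p _ <-]; rewrite BE.
    exact: (hausdorff_dim_Xset_le hd mu p alpha _ _ (g p)) (neX q dq).
  apply: le_trans (hausdorff_dim_Xset_ge mu q alpha _ _ (g q) (aeX q dq)).
  by apply: ereal_inf_lbound; exists q => //; rewrite BE.
Qed.
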